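(* Let $A$ and $B$ be Leibniz algebras over a field $\mathbb{F}$, let $(\varphi,\varphi',f)$ be a factor system of $A$ by $B$, and let $L$ denote the vector space $A\oplus B$ with multiplication $(m,i)(n,j)=(mn+\varphi(i)n+\varphi'(j)m+f(i,j),\ ij)$ for $m,n\in A$ and $i,j\in B$. Let $\sigma:A\to L$ be given by $\sigma(m)=(m,0)$, $\pi:L\to B$ by $\pi(m,i)=i$, and $T:B\to L$ by $T(i)=(0,i)$. Then: (1) $L$ is a Leibniz algebra. (2) $0\to A\xrightarrow{\sigma}L\xrightarrow{\pi}B\to0$ is an extension of $A$ by $B$. (3) $\pi T=I_B$. (4) The factor system $(\varphi,\varphi',f)$ belongs to the extension and $T$.
   Context: All algebras are vector spaces over a fixed field $\mathbb{F}$ with a bilinear multiplication (juxtaposition). A Leibniz algebra is an algebra satisfying $x(yz)=(xy)z+y(xz)$ for all $x,y,z$. $\mathcal{L}(A)$ is the space of linear maps $A\to A$, $\mathrm{Der}(A)\subseteq\mathcal{L}(A)$ the space of derivations ($D(mn)=D(m)n+mD(n)$), and $\mathrm{ad}^l_m n=mn$, $\mathrm{ad}^r_m n=nm$. A factor system of $A$ by $B$ is a tuple $(\varphi,\varphi',f)$ with $\varphi:B\to\mathrm{Der}(A)$ linear, $\varphi':B\to\mathcal{L}(A)$ linear, $f:B\times B\to A$ bilinear, such that for all $m,n\in A$, $i,j,k\in B$: (1) $m(\varphi(i)n)=(\varphi'(i)m)n+\varphi(i)(mn)$; (2) $m(\varphi'(i)n)=\varphi'(i)(mn)+n(\varphi'(i)m)$;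 (3) $\mathrm{ad}^r_{f(i,j)}+\varphi'(ij)=\varphi'(j)\varphi'(i)+\varphi(i)\varphi'(j)$; (4) $\varphi(i)(mn)=(\varphi(i)m)n+m(\varphi(i)n)$; (5) $\varphi(i)\varphi(j)=\varphi(ij)+\varphi(j)\varphi(i)+\mathrm{ad}^l_{f(i,j)}$; (6) $\varphi(i)\varphi'(j)=\varphi'(j)\varphi(i)+\varphi'(ij)+\mathrm{ad}^r_{f(i,j)}$; (7) $f(i,jk)+\varphi(i)f(j,k)=f(ij,k)+\varphi'(k)f(i,j)+f(j,ik)+\varphi(j)f(i,k)$. An extension of $A$ by $B$ is a short exact sequence $0\to A\xrightarrow{\sigma}L\xrightarrow{\pi}B\to0$ with $L$ a Leibniz algebra and $\sigma,\pi$ algebra homomorphisms. A section is a linear map $T:B\to L$ with $\pi T=I_B$. For $x\in L$, $m\in A$ put $P(x)m=\sigma^{-1}(x\sigma(m))$ and $P'(x)m=\sigma^{-1}(\sigma(m)x)$. A factor system $(\varphi,\varphi',f)$ belongs to the extension and $T$ if $\varphi=PT$, $\varphi'=P'T$, and $\sigma(f(i,j))=T(i)T(j)-T(ij)$ for all $i,j\in B$. *)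

(* Defs.v *)
From mathcomp Require Import all_boot all_algebra.
From mathcomp Require Import boolp classical_sets functions.

Set Implicit Arguments.
Unset Strict Implicit.
Unset Printing Implicit Defensive.

Import GRing.Theory.
Local Open Scope ring_scope.

(* An algebra over F is an lmodType V together with a bilinear map
   mul : V -> V -> V; associativity, a unit and finite dimension are not
   assumed.  The library's bilinear_for lives in Type, so it cannot be a
   conjunct of a conclusion; this is the same condition in Prop. *)
Definition is_bilinear (F : fieldType) (U V W : lmodType F)
    (g : U -> V -> W) : Prop :=
  (forall v, linear (g^~ v)) /\ (forall u, linear (g u)).

Definition leibniz_algebra (F : fieldType) (V : lmodType F)
    (mul : V -> V -> V) : Prop :=
  is_bilinear mul /\
  forall x y z, mul x (mul y z) = mul (mul x y) z + mul y (mul x z).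

Definition algebra_hom (F : fieldType) (V W : lmodType F)
    (mulV : V -> V -> V) (mulW : W -> W -> W) (h : V -> W) : Prop :=
  linear h /\ forall x y, h (mulV x y) = mulW (h x) (h y).

Definition derivation (F : fieldType) (V : lmodType F)
    (mul : V -> V -> V) (D : V -> V) : Prop :=
  linear D /\ forall m n, D (mul m n) = mul (D m) n + mul m (D n).

Definition adl (V : Type) (mul : V -> V -> V) (m : V) : V -> V :=
  fun n => mul m n.
Definition adr (V : Type) (mul : V -> V -> V) (m : V) : V -> V :=
  fun n => mul n m.

(* A linear map B -> L(A) is represented by its uncurried form, that is, by a
   bilinear map B -> A -> A; equality in L(A) is pointwise equality (=1). *)
Record factor_system (F : fieldType) (A B : lmodType F)
    (mulA : A -> A -> A) (mulB : B -> B -> B)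
    (phi phi' : B -> A -> A) (f : B -> B -> A) : Prop := FactorSystem {
  fs_phi_linear : is_bilinear phi;
  fs_phi_der : forall i, derivation mulA (phi i);
  fs_phi'_linear : is_bilinear phi';
  fs_f_bilinear : is_bilinear f;
  fs_eq1 : forall i m n,
    mulA m (phi i n) = mulA (phi' i m) n + phi i (mulA m n);
  fs_eq2 : forall i m n,
    mulA m (phi' i n) = phi' i (mulA m n) + mulA n (phi' i m);
  fs_eq3 : forall i j,
    adr mulA (f i j) \+ phi' (mulB i j)
      =1 (phi' j \o phi' i) \+ (phi i \o phi' j);
  fs_eq4 : forall i m n,
    phi i (mulA m n) = mulA (phi i m) n + mulA m (phi i n);
  fs_eq5 : forall i j,
    phi i \o phi j
      =1 phi (mulB i j) \+ (phi j \o phi i) \+ adl mulA (f i j);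
  fs_eq6 : forall i j,
    phi i \o phi' j
      =1 (phi' j \o phi i) \+ phi' (mulB i j) \+ adr mulA (f i j);
  fs_eq7 : forall i j k,
    f i (mulB j k) + phi i (f j k)
      = f (mulB i j) k + phi' k (f i j) + f j (mulB i k) + phi j (f i k)
}.

Record extension (F : fieldType) (A L B : lmodType F)
    (mulA : A -> A -> A) (mulL : L -> L -> L) (mulB : B -> B -> B)
    (sigma : A -> L) (pi : L -> B) : Prop := Extension {
  ext_leibniz : leibniz_algebra mulL;
  ext_sigma_hom : algebra_hom mulA mulL sigma;
  ext_pi_hom : algebra_hom mulL mulB pi;
  ext_sigma_inj : injective sigma;
  ext_exact : forall x, pi x = 0 <-> exists m, sigma m = x;
  ext_pi_surj : forall i, exists x, pi x = i
}.

Definition section (F : fieldType) (L B : lmodType F)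
    (pi : L -> B) (T : B -> L) : Prop :=
  linear T /\ pi \o T =1 id.

(* The inverse of sigma on its range, with junk value 0 elsewhere.  For an
   extension the junk value is never used by ext_P and ext_P' below, see
   ext_PE and ext_P'E. *)
Definition sigma_inv (F : fieldType) (A L : lmodType F)
    (sigma : A -> L) : L -> A :=
  'pinv_(fun=> 0) [set: A] sigma.

Definition ext_P (F : fieldType) (A L : lmodType F)
    (mulL : L -> L -> L) (sigma : A -> L) (x : L) (m : A) : A :=
  sigma_inv sigma (mulL x (sigma m)).

Definition ext_P' (F : fieldType) (A L : lmodType F)
    (mulL : L -> L -> L) (sigma : A -> L) (x : L) (m : A) : A :=
  sigma_inv sigma (mulL (sigma m) x).

Record belongs (F : fieldType) (A L B : lmodType F)
    (mulL : L -> L -> L) (mulB : B -> B -> B) (sigma : A -> L) (T : B -> L)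
    (phi phi' : B -> A -> A) (f : B -> B -> A) : Prop := Belongs {
  bel_phi : forall i, phi i =1 ext_P mulL sigma (T i);
  bel_phi' : forall i, phi' i =1 ext_P' mulL sigma (T i);
  bel_f : forall i j, sigma (f i j) = mulL (T i) (T j) - T (mulB i j)
}.

Definition fs_mul (F : fieldType) (A B : lmodType F)
    (mulA : A -> A -> A) (mulB : B -> B -> B)
    (phi phi' : B -> A -> A) (f : B -> B -> A) (x y : A * B) : A * B :=
  let: (m, i) := x in
  let: (n, j) := y in
  (mulA m n + phi i n + phi' j m + f i j, mulB i j).

Lemma sigma_invK (F : fieldType) (A L : lmodType F) (sigma : A -> L) (x : L) :
  (exists m, sigma m = x) -> sigma (sigma_inv sigma x) = x.
Proof. by move=> [m <-]; apply: pinvK; apply/mem_set; exists m. Qed.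

Section ExtensionP.
Variables (F : fieldType) (A L B : lmodType F).
Variables (mulA : A -> A -> A) (mulL : L -> L -> L) (mulB : B -> B -> B).
Variables (sigma : A -> L) (pi : L -> B).
Hypotheses (algB : is_bilinear mulB).
Hypothesis E : extension mulA mulL mulB sigma pi.

Let mulB0 i : mulB i 0 = 0.
Proof. by have := algB.2 i (-1) 0 0; rewrite scaler0 addr0 scaleN1r addNr. Qed.

Let mul0B i : mulB 0 i = 0.
Proof. by have := algB.1 i (-1) 0 0; rewrite scaler0 addr0 scaleN1r addNr. Qed.

Let pi_sigma m : pi (sigma m) = 0.
Proof. by apply/(ext_exact E); exists m. Qed.

Lemma ext_PE x m : sigma (ext_P mulL sigma x m) = mulL x (sigma m).
Proof.
apply: sigma_invK; apply/(ext_exact E).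
by rewrite (ext_pi_hom E).2 pi_sigma mulB0.
Qed.

Lemma ext_P'E x m : sigma (ext_P' mulL sigma x m) = mulL (sigma m) x.
Proof.
apply: sigma_invK; apply/(ext_exact E).
by rewrite (ext_pi_hom E).2 pi_sigma mul0B.
Qed.

End ExtensionP.

(* Main.v *)
Require Import Defs.
From mathcomp Require Import all_boot all_algebra.

(** The product of [A * B] is built so that each condition on a factor system
    is one multihomogeneous part of the Leibniz identity.  Write [x = (m, i)],
    [y = (n, j)], [z = (p, k)].  The [B]-components of [x (y z)] and
    [(x y) z + y (x z)] agree by the Leibniz identity of [B].  Expanded by
    bilinearity, the [A]-components are sums of terms that are linear in one
    of [m, i], in one of [n, j] and in one of [p, k], and they agree part by
    part:
    - the part in [m, n, p] is the Leibniz identity of [A];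
    - the parts in [m, j, p], in [m, n, k] and in [i, n, p] are [fs_eq1],
      [fs_eq2] and [fs_eq4];
    - the parts in [m, j, k], in [i, j, p] and in [i, n, k] are [fs_eq3],
      [fs_eq5] and [fs_eq6];
    - the part in [i, j, k] is the cocycle condition [fs_eq7].
    This is [fs_mul_leibniz].  The rest follows from the products of elements
    [(m, 0)] and [(0, i)], where bilinearity kills all but one of the four
    terms of the [A]-component: they show that [sigma] is a homomorphism, and
    that [T(i) sigma(m)], [sigma(m) T(i)] and [T(i) T(j) - T(i j)] are the
    images under [sigma] of [phi i m], [phi' i m] and [f i j]. *)

Import GRing.Theory.
Local Open Scope ring_scope.

Section LinearProp.

Set Implicit Arguments.
Unset Strict Implicit.

Variables (F : fieldType) (U V : lmodType F).

Lemma linear_add (h : U -> V) : linear h -> {morph h : x y / x + y}.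
Proof. by move=> lh x y; have := lh 1 x y; rewrite !scale1r. Qed.

Lemma linear_zero (h : U -> V) : linear h -> h 0 = 0.
Proof.
by move=> lh; have := lh (-1) 0 0; rewrite scaler0 addr0 scaleN1r addNr.
Qed.

End LinearProp.

Section BilinearProp.

Set Implicit Arguments.
Unset Strict Implicit.

Variables (F : fieldType) (U V W : lmodType F) (g : U -> V -> W).
Hypothesis bg : is_bilinear g.

Lemma bilinear_addl u u' v : g (u + u') v = g u v + g u' v.
Proof. exact: (linear_add (bg.1 v) u u'). Qed.

Lemma bilinear_addr u v v' : g u (v + v') = g u v + g u v'.
Proof. exact: (linear_add (bg.2 u) v v'). Qed.

Lemma bilinear_zerol v : g 0 v = 0.
Proof. exact: (linear_zero (bg.1 v)). Qed.

Lemma bilinear_zeror u : g u 0 = 0.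
Proof. exact: (linear_zero (bg.2 u)). Qed.

Lemma bilinear_linl a u u' v : g (a *: u + u') v = a *: g u v + g u' v.
Proof. exact: bg.1. Qed.

Lemma bilinear_linr a u v v' : g u (a *: v + v') = a *: g u v + g u v'.
Proof. exact: bg.2. Qed.

End BilinearProp.

Section PairOperations.

Set Implicit Arguments.
Unset Strict Implicit.

Variables (F : fieldType) (U V : lmodType F).

Lemma pair_add (u u' : U) (v v' : V) : (u, v) + (u', v') = (u + u', v + v').
Proof. by []. Qed.

Lemma pair_scale (a : F) (u : U) (v : V) : a *: (u, v) = (a *: u, a *: v).
Proof. by []. Qed.

End PairOperations.

Section FactorSystemProduct.

Set Implicit Arguments.
Unset Strict Implicit.

Variables (F : fieldType) (A B : lmodType F).
Variables (mulA : A -> A -> A) (mulB : B -> B -> B).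
Variables (phi phi' : B -> A -> A) (f : B -> B -> A).

Local Notation mulL := (fs_mul mulA mulB phi phi' f).

Lemma fs_mul_bilinear :
  is_bilinear mulA -> is_bilinear mulB -> is_bilinear phi ->
  is_bilinear phi' -> is_bilinear f -> is_bilinear mulL.
Proof.
move=> bA bB bp bp' bf; split=> [[n j] a [m i] [m' i']|[m i] a [n j] [n' j']].
  rewrite pair_scale pair_add /fs_mul pair_scale pair_add; congr pair.
    rewrite (bilinear_linl bA) (bilinear_linl bp) (bilinear_linr bp').
    rewrite (bilinear_linl bf) !scalerDr !addrA.
    by rewrite [LHS](ACl (1*3*5*7*2*4*6*8)).
  exact: bilinear_linl.
rewrite pair_scale pair_add /fs_mul pair_scale pair_add; congr pair.
  rewrite (bilinear_linr bA) (bilinear_linr bp) (bilinear_linl bp').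
  rewrite (bilinear_linr bf) !scalerDr !addrA.
  by rewrite [LHS](ACl (1*3*5*7*2*4*6*8)).
exact: bilinear_linr.
Qed.

Hypotheses (leibA : leibniz_algebra mulA) (leibB : leibniz_algebra mulB).
Hypothesis fs : factor_system mulA mulB phi phi' f.

Let bA := leibA.1.
Let bB := leibB.1.
Let bphi := fs_phi_linear fs.
Let bphi' := fs_phi'_linear fs.
Let bf := fs_f_bilinear fs.

Lemma fs_mul_leibniz : leibniz_algebra mulL.
Proof.
split; first exact: fs_mul_bilinear.
move=> [m i] [n j] [p k]; rewrite /fs_mul pair_add.
congr pair; last exact: leibB.2.
rewrite !(bilinear_addl bA, bilinear_addr bA) !(bilinear_addr bphi).
rewrite !(bilinear_addr bphi') !addrA.
have eq3 := fs_eq3 fs j k m; have eq5 := fs_eq5 fs i j p.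
have eq6 := fs_eq6 fs i k n; rewrite /adr /adl /= in eq3 eq5 eq6.
(* One parenthesized or single factor per homogeneous part, in the order
   mnp, mjp, mnk, mjk, inp, ijp, ink, ijk. *)
rewrite [LHS](ACl (1*2*3*(4*9)*5*6*7*(10*8))) /=.
rewrite leibA.2 (fs_eq1 fs j m p) (fs_eq2 fs k m n) eq3 (fs_eq4 fs i n p).
rewrite eq5 eq6 (fs_eq7 fs).
rewrite !addrA.
by rewrite [LHS](ACl (1*9*3*13*11*5*14*7*18*17*2*10*6*16*4*12*8*20*15*19)).
Qed.

Lemma fs_mul_inlr m i : mulL (m, 0) (0, i) = (phi' i m, 0).
Proof.
rewrite /fs_mul (bilinear_zeror bA) (bilinear_zerol bphi).
by rewrite (bilinear_zerol bf) (bilinear_zerol bB) !add0r addr0.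
Qed.

Lemma fs_mul_inrl i m : mulL (0, i) (m, 0) = (phi i m, 0).
Proof.
rewrite /fs_mul (bilinear_zerol bA) (bilinear_zerol bphi').
by rewrite (bilinear_zeror bf) (bilinear_zeror bB) add0r !addr0.
Qed.

Lemma fs_mul_inl m n : mulL (m, 0) (n, 0) = (mulA m n, 0).
Proof.
rewrite /fs_mul (bilinear_zerol bphi) (bilinear_zerol bphi').
by rewrite (bilinear_zerol bf) (bilinear_zerol bB) !addr0.
Qed.

Lemma fs_mul_inr i j : mulL (0, i) (0, j) = (f i j, mulB i j).
Proof.
rewrite /fs_mul (bilinear_zerol bA) (bilinear_zeror bphi).
by rewrite (bilinear_zeror bphi') !add0r.
Qed.

Lemma fs_mul_extension :
  extension mulA mulL mulB (fun m => (m, 0)) (fun x => x.2).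
Proof.
split.
- exact: fs_mul_leibniz.
- split=> [a m n|m n]; last by rewrite fs_mul_inl.
  by rewrite pair_scale pair_add scaler0 addr0.
- by split=> [a x y|[m i] [n j]].
- by move=> m n [].
- by move=> [m i]; split=> [/= ->|[n [_ <-]]]; first by exists m.
- by move=> i; exists (0, i).
Qed.

(** [ext_P] and [ext_P'] involve a chosen inverse of [sigma]; since [sigma] is
    injective, it suffices to compare images under [sigma], where [ext_PE] and
    [ext_P'E] turn the inverse into a product of the extension. *)
Lemma fs_mul_belongs :
  belongs mulL mulB (fun m => (m, 0)) (fun i => (0, i)) phi phi' f.
Proof.
split=> [i m|i m|i j].
- apply: (ext_sigma_inj fs_mul_extension).
  by rewrite (ext_PE bB fs_mul_extension) fs_mul_inrl.
- apply: (ext_sigma_inj fs_mul_extension).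
  by rewrite (ext_P'E bB fs_mul_extension) fs_mul_inlr.
- by apply/eqP; rewrite eq_sym subr_eq fs_mul_inr pair_add addr0 add0r.
Qed.

End FactorSystemProduct.

Theorem theorem3p2 (F : fieldType) (A B : lmodType F)
    (mulA : A -> A -> A) (mulB : B -> B -> B)
    (phi phi' : B -> A -> A) (f : B -> B -> A)
    (leibA : leibniz_algebra mulA) (leibB : leibniz_algebra mulB)
    (fs : factor_system mulA mulB phi phi' f) :
  let L : lmodType F := (A * B)%type in
  let mulL : L -> L -> L := fs_mul mulA mulB phi phi' f in
  let sigma : A -> L := fun m => (m, 0) in
  let pi : L -> B := fun x => x.2 in
  let T : B -> L := fun i => (0, i) in
  [/\ leibniz_algebra mulL,
      extension mulA mulL mulB sigma pi,
      section pi T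
    & belongs mulL mulB sigma T phi phi' f].
Proof.
split.
- exact: fs_mul_leibniz.
- exact: fs_mul_extension.
- split=> // a i j.
  by rewrite pair_scale pair_add scaler0 addr0.
- exact: fs_mul_belongs.
Qed.
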